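(* Let $G$ be a finite group. Then $G$ is $(\ast)$-coverable if and only if $G$ is a Frobenius-Wielandt group.
   Context: For a subgroup $H$ of a group $G$ and $g\in G$, $H^g=g^{-1}Hg$. A covering of a finite group $G$ is a set of proper subgroups of $G$ whose set-theoretical union is $G$ and such that no member of the set is contained in another (different) member of the set. A finite group $G$ is called $(\ast)$-coverable if there exist proper subgroups $H,K$ of $G$ such that $\delta=\{H^g,K: g\in G\}$ is a covering of $G$. A group $G$ is a Frobenius-Wielandt group if it has a subgroup $H$ with $1\neq H\neq G$ and a proper normal subgroup $N$ of $H$ (that is, $N\lhd H$, $N\ne H$) such that $H\cap H^g\leq N$ for all $g\in G\setminus H$. *)

(* Defs.v *)
From HB Require Import structures.
From mathcomp Require Import all_boot all_order all_fingroup.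

Set Implicit Arguments.
Unset Strict Implicit.
Unset Printing Implicit Defensive.

Local Open Scope group_scope.

Definition covering (gT : finGroupType) (G : {group gT})
    (D : {set {group gT}}) : Prop :=
  [/\ forall A : {group gT}, A \in D -> A \proper G,
      \bigcup_(A in D) (A : {set gT}) = G
    & forall A B : {group gT}, A \in D -> B \in D -> A \subset B -> A = B].

Definition star_coverable (gT : finGroupType) (G : {group gT}) : Prop :=
  exists H K : {group gT},
    [/\ H \proper G, K \proper G
      & covering G (K |: [set (H :^ g)%G | g in G])].

Definition Frobenius_Wielandt (gT : finGroupType) (G : {group gT}) : Prop :=
  exists H N : {group gT},
    [/\ H \subset G, H :!=: 1, H :!=: G, N <| H & N :!=: H] /\
    (forall g, g \in G :\: H -> H :&: H :^ g \subset N).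

(* Main.v *)
(** If [G] is covered by the conjugates of [H] together with [K], conjugating
    shows that [K] may be replaced by its normal core [L].  The conjugates of
    [A = H \ L] then cover [G \ L], and comparing [|G \ L|] with [|G : H| |A|]
    leaves no room for overlaps: [A] is a TI-set with normaliser [H], so that
    [(H, H :&: L)] is a Frobenius-Wielandt pair.

    The converse is Wielandt's theorem: the elements of [G] outside every
    conjugate of [H \ N] form a normal subgroup [K] with [H :&: K = N].  As in
    Frobenius's theorem, each irreducible character [chi] of [H] with [N] in its
    kernel extends to an irreducible character of [G], namely
    [Ind (chi - chi 1) + chi 1], whose kernel contains all these elements; [K]
    is the intersection of the kernels of the irreducible characters of [G]
    with this last property. *)
Require Import Defs.
From HB Require Import structures.
From mathcomp Require Import all_boot all_order all_fingroup.
From mathcomp Require Import ssralg zmodp ssrnum archimedean algC.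
From mathcomp Require Import frobenius classfun character vcharacter.

Set Implicit Arguments.
Unset Strict Implicit.
Unset Printing Implicit Defensive.

Section TrivialIntersection.

Local Open Scope group_scope.

Variables (gT : finGroupType) (G : {group gT}).
Implicit Types (A : {set gT}) (H : {group gT}).

(** The class support is the union of the [#|G : 'N_G(A)|] distinct conjugates of [A], all of the
    same size; the bound is attained exactly when they are disjoint. *)
Lemma leqif_card_class_support A :
  #|class_support A G| <= (#|G : 'N_G(A)| * #|A|)%N ?= iff trivIset (A :^: G).
Proof.
have -> : (#|G : 'N_G(A)| * #|A|)%N = \sum_(B in A :^: G) #|B|.
  rewrite -card_conjugates -sum_nat_const.
  by apply: eq_bigr => _ /imsetP[x _ ->]; rewrite cardJg.
by rewrite class_supportEr -cover_imset; apply: leq_card_cover.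
Qed.

Lemma leq_card_class_support A H :
  H \subset 'N_G(A) -> #|class_support A G| <= #|G : H| * #|A|.
Proof.
move=> sHN; apply: leq_trans (leqif_card_class_support A).1 _.
by rewrite leq_mul2r dvdn_leq ?orbT // indexgS.
Qed.

(** The hypothesis closes the chain from [#|class_support A G|] through [#|G : 'N_G(A)| * #|A|] to
    [#|G : H| * #|A|]. Equality in the first step makes the conjugates disjoint, in the second makes
    [H] the whole normaliser. *)
Lemma normedTI_card A H :
    A != set0 -> H \subset 'N_G(A) ->
  #|G : H| * #|A| <= #|class_support A G| -> normedTI A G H.
Proof.
move=> nzA sHN leHA; have A_gt0 : 0 < #|A| by rewrite card_gt0.
have [leAN eqAN] := leqif_card_class_support A.
have leN : #|G : 'N_G(A)| <= #|G : H| by rewrite dvdn_leq // indexgS.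
have leH : #|G : H| <= #|G : 'N_G(A)|.
  by rewrite -(leq_pmul2r A_gt0) (leq_trans leHA).
have eqi : #|G : H| = #|G : 'N_G(A)| by apply/eqP; rewrite eqn_leq leH.
apply/and3P; split=> //; first by rewrite -eqAN eqn_leq leAN -eqi.
rewrite eq_sym eqEcard sHN /=.
rewrite -(leq_pmul2r (indexg_gt0 G H)) Lagrange ?(subset_trans sHN) ?subsetIl //.
by rewrite eqi Lagrange ?subsetIl.
Qed.

End TrivialIntersection.

Section StarCoverable.

Local Open Scope group_scope.

Variables (gT : finGroupType) (G : {group gT}).

(** If [x] avoids every conjugate of [H], so do all conjugates of [x], which therefore all lie in
    [K]. *)
Lemma covering_sub_class_support_gcore (H K : {group gT}) :
    covering G (K |: [set (H :^ g)%G | g in G]) ->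
  G \subset class_support H G :|: gcore K G.
Proof.
case=> _ defG _; apply/subsetP=> x Gx; rewrite inE.
have [// | notHx /=] := boolP (x \in class_support H G).
apply/bigcapP=> g Gg; rewrite mem_conjg.
have: x ^ g^-1 \in G by rewrite groupJ ?groupV.
rewrite -{1}defG => /bigcupP[B /setU1P[-> // | /imsetP[h Gh ->]]] /=.
rewrite mem_conjg -conjgM => Hx; case/imset2P: notHx.
exists (x ^ (g^-1 * h^-1)) (h * g) => //; first exact: groupM.
by rewrite -conjgM mulgA mulgKV mulVg conjg1.
Qed.

Lemma star_coverable_Frobenius_Wielandt :
  star_coverable G -> Frobenius_Wielandt G.
Proof.
case=> H [K [prHG prKG /covering_sub_class_support_gcore sGHL]].
have [sHG _] := andP prHG; pose L := [group of gcore K G].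
have nsLG : L <| G by apply: gcore_normal; apply: proper_sub.
pose A := H :\: L.
have nAH : H \subset 'N_G(A).
  by rewrite subsetI sHG normsD ?normG // (subset_trans sHG) ?normal_norm.
have nzA : A != set0.
  (* If [H] lay in the normal subgroup [L], so would its conjugates, forcing [G] into [K]. *)
  apply: contraL prKG; rewrite setD_eq0 => sHL.
  rewrite properE negb_and negbK; apply/orP; right.
  apply: subset_trans (gcore_sub K G); apply: subset_trans sGHL _.
  rewrite subUset subxx andbT class_supportEr; apply/bigcupsP=> g Gg.
  by rewrite -(normP (subsetP (normal_norm nsLG) g Gg)) conjSg.
have tiA : normedTI A G H.
  apply: normedTI_card => //.
  have sGLA : G :\: L \subset class_support A G.
    apply/subsetP=> x /setDP[Gx notLx].
    have:= subsetP sGHL x Gx; rewrite inE (negPf notLx) orbF.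
    case/imset2P=> h g Hh Gg def_x; rewrite def_x imset2_f // inE Hh andbT.
    apply: contra notLx => Lh; rewrite def_x.
    by rewrite memJ_norm ?(subsetP (normal_norm nsLG)).
  apply: leq_trans (subset_leq_card sGLA).
  rewrite !cardsD (setIidPr (normal_sub nsLG)) mulnBr mulnC Lagrange //.
  (* What remains is [#|L| <= #|G : H| * #|H :&: L|]; times [#|H|], it follows from the product
     formula and [H * L \subset G]. *)
  apply: leq_sub2l; rewrite -(leq_pmul2l (cardG_gt0 H)) mulnA Lagrange //.
  rewrite mul_cardG leq_mul2r subset_leq_card ?orbT //.
  exact: mul_subG sHG (normal_sub nsLG).
have [_ _ memJA] := normedTI_memJ_P tiA.
have prHL : H :&: L \proper H by rewrite properE subsetIl subsetIidl -setD_eq0.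
exists H, [group of H :&: L]; split; last first.
  move=> g /setDP[Gg notHg]; apply/subsetP=> x /setIP[Hx Hgx].
  rewrite inE Hx /=; apply: contraR notHg => notLx.
  have Hxg : x ^ g^-1 \in H by rewrite -mem_conjg.
  rewrite -groupV -(memJA x) ?groupV //; last by apply/setDP.
  by rewrite inE Hxg memJ_norm ?notLx ?groupV // (subsetP (normal_norm nsLG)).
split=> //; last by rewrite proper_neq.
- apply: contraTneq prHL => ->; rewrite properE negb_and negbK.
  by rewrite sub1G orbT.
- by rewrite proper_neq.
exact: normalGI sHG nsLG.
Qed.

End StarCoverable.

Section Wielandt.

Local Open Scope group_scope.
Variables (gT : finGroupType) (G H N : {group gT}).
Hypotheses (sHG : H \subset G) (nsNH : N <| H).
Hypothesis tiHN : {in G :\: H, forall g, H :&: H :^ g \subset N}.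

Lemma Wielandt_conj_notin x y :
  x \in H -> y \in G :\: H -> x ^ y \notin H :\: N.
Proof.
move=> Hx /tiHN/subsetP/(_ (x ^ y)); rewrite !inE memJ_conjg Hx andbT.
by case: (x ^ y \in H) => [-> // |]; rewrite andbF.
Qed.

Local Open Scope ring_scope.
Import Order.TTheory GRing.Theory Num.Theory.

Lemma Wielandt_irr_ext (i : Iirr H) : N \subset cfker 'chi_i ->
  exists2 j : Iirr G, {in H, 'chi_j =1 'chi_i}
                & G :\: class_support (H :\: N) G \subset cfker 'chi_j.
Proof.
move=> kerN; have [-> | nz_i] := eqVneq i 0.
  exists 0 => [x Hx|]; last by rewrite irr0 cfker_cfun1 subsetDl.
  by rewrite !irr0 !cfun1E Hx (subsetP sHG).
have chi1 : '['chi_i, 1] = 0 by rewrite -irr0 cfdot_irr (negPf nz_i).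
pose a := 'chi_i 1%g; pose theta := 'chi_i - a%:A.
pose phi := 'Ind[G] theta + a%:A.
have theta0 x : x \notin H :\: N -> theta x = 0.
  have [Hx | /cfun0-> //] := boolP (x \in H).
  rewrite inE Hx andbT negbK => Nx.
  by rewrite !cfunE cfun1E Hx mulr1 cfker1 ?subrr // (subsetP kerN).
have ResInd : 'Res ('Ind[G] theta) = theta.
  apply/cfun_inP=> x Hx; rewrite cfResE ?cfIndE //.
  (* Conjugators outside [H] send [x] to zeros of [theta]; each of those in [H] contributes
     [theta x]. *)
  apply: canLR (mulKf (neq0CG H)) _; rewrite (big_setID H) /= (setIidPr sHG).
  rewrite [X in _ + X]big1 ?addr0 => [|y /Wielandt_conj_notin/theta0-> //].
  by rewrite mulr_natl -sumr_const; apply: eq_bigr => y Hy; rewrite cfunJ.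
have phi_H : {in H, phi =1 'chi_i}.
  move=> x Hx; rewrite cfunE -(cfResE _ sHG) // ResInd.
  by rewrite !cfunE !cfun1E Hx (subsetP sHG) // subrK.
have phi1 : '[phi, 1] = 0.
  rewrite cfdotDl -cfdot_Res_r cfRes_cfun1 // cfdotBl !cfdotZl !cfnorm1.
  by rewrite chi1 add0r addNr.
have norm_phi : '[phi] = 1.
  (* Induction preserves the norm of [theta] by Frobenius reciprocity; as [phi] and ['chi_i] are
     both orthogonal to [1], the norm of [a%:A] cancels. *)
  have: '[phi - a%:A] = '[theta] by rewrite addrK -cfdot_Res_l ResInd.
  rewrite !cfnormBd ?cfnormZ ?cfdotZr ?phi1 ?chi1 ?mulr0 //.
  by rewrite !cfnorm1 cfnorm_irr => /addIr.
have Zphi : phi \in 'Z[irr G].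
  have Za : a \in Num.int by rewrite intrE Cnat_irr1.
  by rewrite rpredD ?cfInd_vchar ?rpredB ?irr_vchar // scale_zchar ?rpred1.
have [b [j def_phi]] := vchar_norm1P Zphi norm_phi.
have phi_j : phi = 'chi_j.
  (* A negative sign is excluded by the degree, as [phi] and ['chi_i] agree at [1]. *)
  case: b def_phi => [def_phi|->]; last by rewrite scale1r.
  have /eqP := phi_H 1%g (group1 H).
  rewrite def_phi scaleN1r cfunE -subr_eq0 -opprD oppr_eq0 gt_eqF //.
  by rewrite addr_gt0 ?irr1_gt0.
exists j; rewrite ?cfkerEirr -phi_j //.
(* All conjugates of such an [x] are zeros of [theta], so [phi x = a], the degree of [phi]. *)
apply/subsetP=> x /setDP[Gx notAx].
rewrite inE (phi_H 1%g) // cfunE cfIndE // big1 ?mulr0 ?add0r.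
  by rewrite cfunE cfun1E Gx mulr1.
move=> y Gy; apply/theta0; apply: contra notAx => Axy.
by rewrite -(conjgK y x) imset2_f ?groupV.
Qed.

Lemma Wielandt_kernel : exists2 K : {group gT},
  K <| G /\ H :&: K \subset N & G :\: class_support (H :\: N) G \subset K.
Proof.
pose ext (j : Iirr G) :=
  G :\: class_support (H :\: N) G \subset cfker 'chi_j.
exists (\bigcap_(j | ext j) cfker 'chi_j)%G; last by apply/bigcapsP.
split.
  rewrite /normal norms_bigcap ?andbT; last first.
    by apply/bigcapsP=> j _; apply: cfker_norm.
  rewrite (bigcap_min (0 : Iirr G)) ?cfker_sub // /ext.
  by rewrite irr0 cfker_cfun1 subsetDl.
(* [N] is the intersection of the kernels of the irreducible characters of [H] trivial on it, and
   each of these extends to a character satisfying [ext]. *)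
rewrite -(cap_cfker_normal nsNH) /=; apply/bigcapsP=> i kerN.
have [j def_j ext_j] := Wielandt_irr_ext kerN.
apply/subsetP=> x /setIP[Hx /bigcapP/(_ j ext_j)].
by rewrite !cfkerEirr !inE !def_j.
Qed.

End Wielandt.

Section FrobeniusWielandt.

Local Open Scope group_scope.

Lemma Frobenius_Wielandt_star_coverable (gT : finGroupType) (G : {group gT}) :
  Frobenius_Wielandt G -> star_coverable G.
Proof.
case=> H [N [[sHG _ neqHG nsNH neqNH] tiHN]].
have prHG : H \proper G by rewrite properEneq neqHG.
have [K [nsKG sHKN] sGK] := Wielandt_kernel sHG nsNH tiHN.
have notsHJK g : g \in G -> ~~ (H :^ g \subset K).
  move=> Gg; rewrite -(normP (subsetP (normal_norm nsKG) g Gg)) conjSg.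
  apply: contra neqNH => sHK; rewrite eqEsubset normal_sub //=.
  by rewrite (subset_trans _ sHKN) // subsetI subxx.
have notsKHJ g : g \in G -> ~~ (K \subset H :^ g).
  move=> Gg; rewrite -(normP (subsetP (normal_norm nsKG) g Gg)) conjSg.
  apply: contra neqHG => sKH; rewrite eqEcard sHG.
  (* If [K] lay in [H], it would lie in [N], leaving at most [#|N|] elements outside the class
     support. At least [#|G : H| * #|N|] are outside, so the index would be 1. *)
  have nAH : H \subset 'N_G(H :\: N).
    by rewrite subsetI sHG normsD ?normG // normal_norm.
  have := leq_card_class_support nAH.
  have sKN : K \subset N by apply: subset_trans sHKN; rewrite subsetI sKH subxx.
  have := subset_leq_card (subset_trans sGK sKN).
  rewrite !cardsD (setIidPr (normal_sub nsNH)) (setIidPr _); last first.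
    by rewrite class_support_sub_norm ?subDset ?subsetU ?sHG ?orbT ?normG.
  rewrite leq_subLR mulnBr [X in _ <= X - _]mulnC Lagrange // => leGN leA.
  have leiN : #|G : H| * #|N| <= #|G|.
    rewrite -(Lagrange sHG) mulnC leq_mul2r subset_leq_card ?orbT //.
    exact: normal_sub.
  rewrite leq_subRL // in leA.
  have : #|G : H| * #|N| <= 1 * #|N|.
    rewrite mul1n -(leq_add2r #|class_support (H :\: N) G|) (leq_trans leA) //.
    by rewrite addnC.
  rewrite leq_pmul2r // => le1; rewrite -(Lagrange sHG).
  by rewrite -[leqRHS]muln1 leq_mul2l le1 orbT.
have prKG : K \proper G.
  rewrite properE normal_sub //; apply: contra (notsHJK 1 (group1 G)).
  by rewrite conjsg1; apply: subset_trans.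
exists H, K; split=> //; split.
- by move=> A /setU1P[-> // | /imsetP[g Gg ->]]; rewrite /= -(conjGid Gg) properJ.
- apply/setP=> x; apply/bigcupP/idP=> [[A] | Gx].
    case/setU1P=> [-> | /imsetP[g Gg ->]]; first exact/subsetP/normal_sub.
    by apply/subsetP; rewrite /= -(conjGid Gg) conjSg.
  have [/imset2P[h g /setDP[Hh _] Gg ->] | notAx] :=
      boolP (x \in class_support (H :\: N) G).
    by exists (H :^ g)%G; rewrite ?memJ_conjg // setU1r // imset_f.
  by exists K; rewrite ?setU11 // (subsetP sGK) // inE notAx.
move=> A B /setU1P[->|/imsetP[g Gg ->]] /setU1P[->|/imsetP[h Gh ->]] //=.
- by rewrite (negPf (notsKHJ h Gh)).
- by rewrite (negPf (notsHJK g Gg)).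
by move=> sHgh; apply: val_inj; apply/eqP; rewrite eqEcard /= sHgh !cardJg /=.
Qed.

End FrobeniusWielandt.

Theorem theorem2p10 (gT : finGroupType) (G : {group gT}) :
  star_coverable G <-> Frobenius_Wielandt G.
Proof.
split; first exact: star_coverable_Frobenius_Wielandt.
exact: Frobenius_Wielandt_star_coverable.
Qed.
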